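(* Let $A = B^{-1} + H^\top R^{-1} H \in \mathbb{R}^{d\times d}$ be the posterior curvature (symmetric positive definite, $A\succ 0$), and for $t\in[0,1]$ let $$A_t^\star := \left(\alpha_t^2 A^{-1} + \beta_t^2 I\right)^{-1}, \qquad \alpha_t = 1-t,\quad \beta_t^2 = t,$$ be the pseudo-time-dependent posterior diffusion curvature. Suppose $A$ has the eigendecomposition $A = Q\Lambda Q^\top$ with $Q$ orthogonal and $\Lambda = \operatorname{diag}(\lambda_1,\ldots,\lambda_d)$, and let $\lambda_{\max}$ and $\lambda_{\min}$ be the largest and smallest eigenvalues of $A$, so that $\lambda_{\max}\ge\lambda_i\ge\lambda_{\min}>0$ for all $i$. Then: (1) For each $t\in[0,1]$, the eigenvalues of $A_t^\star$ are $$\lambda_i^\star(t) = \frac{\lambda_i}{\alpha_t^2+\beta_t^2\lambda_i},\qquad i=1,\ldots,d.$$ (2) For each $t\in[0,1]$, the condition number of $A_t^\star$ is $$\kappa(A_t^\star) = \kappa(A)\,\frac{\alpha_t^2+\beta_t^2\lambda_{\min}}{\alpha_t^2+\beta_t^2\lambda_{\max}}.$$ (3) Consequently, $\kappa(A_t^\star)\le\kappa(A)$ for all $t\in[0,1]$, with $\kappa(A_0^\star)=\kappa(A)$ and $\kappa(A_1^\star)=1$; moreover, $t\mapsto\kappa(A_t^\star)$ is monotonically decreasing (in the weak sense, i.e. nonincreasing) on $[0,1]$.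
   Context: $B\in\mathbb{R}^{d\times d}$ (prior/background covariance) and $R\in\mathbb{R}^{m\times m}$ (observation-error covariance) are symmetric positive definite, and $H\in\mathbb{R}^{m\times d}$ is the linear (or linearized) observation operator. For a symmetric positive definite matrix $M$, $\kappa(M)=\lambda_{\max}(M)/\lambda_{\min}(M)$, where $\lambda_{\max}(M)$ and $\lambda_{\min}(M)$ are its largest and smallest eigenvalues. $I$ is the $d\times d$ identity matrix. The noise schedule $\alpha_t=1-t$, $\beta_t^2=t$, $0\le t\le 1$, is the one used throughout the paper. *)

(* Defs.v *)
From HB Require Import structures.
From mathcomp Require Export all_boot all_order all_algebra.
From mathcomp Require Export boolp classical_sets reals.
Set Implicit Arguments.
Unset Strict Implicit.
Unset Printing Implicit Defensive.
Import Order.TTheory GRing.Theory Num.Theory.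
Local Open Scope classical_set_scope.
Local Open Scope ring_scope.

Definition posdefmx (K : realType) (n : nat) (M : 'M[K]_n) : Prop :=
  M \is symmetricmx /\
  forall x : 'cV[K]_n, x != 0 -> 0 < (x^T *m M *m x) 0 0.

Definition spectrum (K : realType) (n : nat) (M : 'M[K]_n) : set K :=
  [set a | eigenvalue M a].

(* [E `&` ubound E] is the set of greatest elements of [E], hence a singleton
   when [M] is symmetric of positive size; the default value 0 only shows up
   for matrices without real eigenvalues. *)
Definition lambda_max (K : realType) (n : nat) (M : 'M[K]_n) : K :=
  xget 0 (spectrum M `&` ubound (spectrum M)).

Definition lambda_min (K : realType) (n : nat) (M : 'M[K]_n) : K :=
  xget 0 (spectrum M `&` lbound (spectrum M)).

Definition cond_num (K : realType) (n : nat) (M : 'M[K]_n) : K :=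
  lambda_max M / lambda_min M.

Definition alpha (K : realType) (t : K) : K := 1 - t.

(* Only the square of beta is prescribed, and only for [0 <= t]. *)
Definition beta (K : realType) (t : K) : K := Num.sqrt t.

Definition posterior_curvature (K : realType) (d m : nat)
    (B : 'M[K]_d) (R : 'M[K]_m) (H : 'M[K]_(m, d)) : 'M[K]_d :=
  invmx B + H^T *m invmx R *m H.

Definition diffusion_curvature (K : realType) (d : nat)
    (A : 'M[K]_d) (t : K) : 'M[K]_d :=
  invmx (alpha t ^+ 2 *: invmx A + (beta t ^+ 2)%:M).

(* Main.v *)
Require Import Defs.
From mathcomp Require Import ring.
Set Implicit Arguments.
Unset Strict Implicit.
Unset Printing Implicit Defensive.
Import Order.TTheory GRing.Theory Num.Theory.
Local Open Scope ring_scope.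

(** The whole statement takes place in one orthonormal basis.  If
    [A = Q diag(l) Q^T], then inversion, scaling and the addition of a scalar
    matrix act entrywise on [l], so [A_t^* = Q diag(l_i / (a + b l_i)) Q^T]
    with [a = alpha t ^+ 2] and [b = beta t ^+ 2 = t]
    ([diffusion_curvature_spectral]).  The eigenvalues, the characteristic
    polynomial and definiteness are then read off the diagonal.

    The map [x |-> x / (a + b x)] is increasing on positive reals, hence the
    indices of the extreme eigenvalues do not move with [t]; dividing the two
    extreme values gives the formula for the condition number
    ([cond_num_diffusion_curvature]).

    For [0 < m <= M], the ratio [(a + b m) / (a + b M)] decreases when the
    weight [b] grows and the weight [a] shrinks, which is what happens as [t]
    increases on [[0, 1]] ([shrink_ratio_le]).  The formula at [t = 0] and
    [t = 1], together with this monotonicity, gives the bounds on the condition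
    number.

    Positivity of the eigenvalues comes from the form of [A]: the inverse of a
    positive definite matrix is positive definite, and a congruence [H^T S H]
    adds only a nonnegative quadratic form ([posdefmx_posterior_curvature]). *)

(** * Positive definite matrices *)

Lemma symmetricmxP (K : realType) (n : nat) (M : 'M[K]_n) :
  reflect (M^T = M) (M \is symmetricmx).
Proof.
apply: (iffP (is_hermitianmxP _ _ _)); rewrite /= expr0 scale1r map_mx_id //.
Qed.

Lemma posdefmx_unit (K : realType) (n : nat) (M : 'M[K]_n) :
  posdefmx M -> M \in unitmx.
Proof.
move=> [_ M_pos]; rewrite -unitmx_tr unitmxE unitfE.
apply/negP => /det0P[v v_neq0 vM].
have /M_pos : v^T != 0 by rewrite trmx_eq0.
by rewrite trmxK -mulmxA -[M *m _]trmxK trmx_mul trmxK vM trmx0 mulmx0 mxE ltxx.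
Qed.

(** Substituting [x = M y] turns the quadratic form of the inverse at [x] into
    that of [M] at [y]. *)
Lemma posdefmx_inv (K : realType) (n : nat) (M : 'M[K]_n) :
  posdefmx M -> posdefmx (invmx M).
Proof.
move=> M_posdef; have M_unit := posdefmx_unit M_posdef.
have [/symmetricmxP M_sym M_pos] := M_posdef.
split=> [|x x_neq0]; first by apply/symmetricmxP; rewrite trmx_inv M_sym.
have y_neq0 : invmx M *m x != 0.
  by apply: contra_neq x_neq0 => y0; rewrite -(mulKVmx M_unit x) y0 mulmx0.
have := M_pos _ y_neq0.
by rewrite trmx_mul trmx_inv M_sym -mulmxA mulKVmx // mulmxA.
Qed.

Lemma posdefmx_add_congr (K : realType) (n m : nat) (M : 'M[K]_n)
    (S : 'M[K]_m) (H : 'M[K]_(m, n)) :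
  posdefmx M -> posdefmx S -> posdefmx (M + H^T *m S *m H).
Proof.
move=> [/symmetricmxP M_sym M_pos] [/symmetricmxP S_sym S_pos].
split=> [|x x_neq0].
  by apply/symmetricmxP; rewrite linearD /= M_sym !trmx_mul trmxK S_sym mulmxA.
rewrite mulmxDr mulmxDl mxE ltr_wpDr ?M_pos //.
have -> : x^T *m (H^T *m S *m H) *m x = (H *m x)^T *m S *m (H *m x).
  by rewrite trmx_mul !mulmxA.
have [->|Hx_neq0] := eqVneq (H *m x) 0; first by rewrite mulmx0 mxE.
exact/ltW/S_pos.
Qed.

Lemma posdefmx_posterior_curvature (K : realType) (d m : nat)
    (B : 'M[K]_d) (R : 'M[K]_m) (H : 'M[K]_(m, d)) :
  posdefmx B -> posdefmx R -> posdefmx (posterior_curvature B R H).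
Proof.
by move=> B_posdef R_posdef; apply: posdefmx_add_congr; apply: posdefmx_inv.
Qed.

(** * Matrices diagonal in a fixed orthonormal basis *)

Definition spectral_mx (K : realType) (n : nat) (Q : 'M[K]_n) (l : 'I_n -> K) :
    'M[K]_n :=
  Q *m diag_mx (\row_i l i) *m Q^T.

Section SpectralMatrix.
Variables (K : realType) (n : nat) (Q : 'M[K]_n).
Hypothesis Q_orthogonal : Q *m Q^T = 1%:M.
Implicit Types l : 'I_n -> K.

Lemma trmx_mul_orthogonal : Q^T *m Q = 1%:M.
Proof. exact: mulmx1C. Qed.

Lemma eq_spectral_mx l l' : l =1 l' -> spectral_mx Q l = spectral_mx Q l'.
Proof.
by move=> eq_l; congr (_ *m diag_mx _ *m _); apply/rowP => i; rewrite !mxE.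
Qed.

Lemma spectral_mx_const c : spectral_mx Q (fun=> c) = c%:M.
Proof.
rewrite /spectral_mx.
have -> : \row_(i < n) c = const_mx c by apply/rowP => i; rewrite !mxE.
by rewrite diag_const_mx mul_mx_scalar -scalemxAl Q_orthogonal scalemx1.
Qed.

Lemma spectral_mxD l l' :
  spectral_mx Q (fun i => l i + l' i) = spectral_mx Q l + spectral_mx Q l'.
Proof.
rewrite /spectral_mx -mulmxDl -mulmxDr -linearD /=.
by congr (_ *m diag_mx _ *m _); apply/rowP => i; rewrite !mxE.
Qed.

Lemma spectral_mxM l l' :
  spectral_mx Q (fun i => l i * l' i) = spectral_mx Q l *m spectral_mx Q l'.
Proof.
rewrite /spectral_mx !mulmxA -(mulmxA _ Q^T Q) trmx_mul_orthogonal mulmx1.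
rewrite -(mulmxA Q (diag_mx _) (diag_mx _)) mulmx_diag.
by congr (_ *m diag_mx _ *m _); apply/rowP => i; rewrite !mxE.
Qed.

Lemma spectral_mxZ c l :
  spectral_mx Q (fun i => c * l i) = c *: spectral_mx Q l.
Proof. by rewrite spectral_mxM spectral_mx_const mul_scalar_mx. Qed.

Lemma spectral_mxV l :
  (forall i, l i != 0) ->
  invmx (spectral_mx Q l) = spectral_mx Q (fun i => (l i)^-1).
Proof.
move=> l_neq0.
have mulV : spectral_mx Q l *m spectral_mx Q (fun i => (l i)^-1) = 1%:M.
  rewrite -spectral_mxM -spectral_mx_const; apply: eq_spectral_mx => i.
  exact: mulfV.
have [l_unit _] := mulmx1_unit mulV.
by rewrite -[RHS](mulKmx l_unit) mulV mulmx1.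
Qed.

(** Conjugation by the constant polynomial matrix [Q] fixes ['X%:M], so it turns
    the characteristic matrix of the diagonal part into that of the product. *)
Lemma char_poly_spectral l :
  char_poly (spectral_mx Q l) = \prod_(i < n) ('X - (l i)%:P).
Proof.
set D := diag_mx (\row_i l i).
have -> : char_poly (spectral_mx Q l) = char_poly D.
  pose Qp := map_mx (@polyC K) Q; pose Qp' := map_mx (@polyC K) Q^T.
  have QpK : Qp *m Qp' = 1%:M by rewrite -map_mxM Q_orthogonal map_mx1.
  have -> : char_poly (spectral_mx Q l) = \det (Qp *m char_poly_mx D *m Qp').
    congr (\det _); rewrite /char_poly_mx /spectral_mx !map_mxM.
    rewrite mulmxBr mulmxBl mul_mx_scalar -scalemxAl.
    by rewrite -/Qp -/Qp' QpK scalemx1.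
  by rewrite !det_mulmx mulrAC -det_mulmx QpK det1 mul1r.
rewrite char_poly_trig ?diag_mx_is_trig //.
by apply: eq_bigr => i _; rewrite !mxE eqxx.
Qed.

Lemma eigenvalue_spectral l a :
  eigenvalue (spectral_mx Q l) a <-> exists i, a = l i.
Proof.
rewrite eigenvalue_root_char char_poly_spectral.
rewrite -(big_map l predT (fun x => 'X - x%:P)) root_prod_XsubC.
split=> [/mapP[i _ ->]|[i ->]]; first by exists i.
by apply: map_f; rewrite mem_index_enum.
Qed.

(** In the coordinates [Q^T x] the quadratic form is a weighted sum of squares,
    so definiteness becomes positivity of the weights. *)
Lemma quadratic_form_spectral l (x : 'cV[K]_n) :
  (x^T *m spectral_mx Q l *m x) 0 0 = \sum_i l i * (Q^T *m x) i 0 ^+ 2.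
Proof.
rewrite /spectral_mx !mulmxA -(mulmxA _ Q^T x) -[x^T *m Q]trmxK trmx_mul trmxK.
rewrite mul_mx_diag mxE; apply: eq_bigr => i _.
by rewrite !mxE expr2 mulrAC mulrC.
Qed.

Lemma posdefmx_spectral l :
  posdefmx (spectral_mx Q l) <-> forall i, 0 < l i.
Proof.
split=> [[_ l_pos] i | l_gt0].
  (* The quadratic form at the column [i] of [Q] is [l i]. *)
  pose x := Q *m (delta_mx i 0 : 'cV[K]_n).
  have QTx : Q^T *m x = delta_mx i 0.
    by rewrite mulmxA trmx_mul_orthogonal mul1mx.
  have x_neq0 : x != 0.
    apply/eqP => x0; move/matrixP/(_ i 0): QTx.
    by rewrite x0 mulmx0 !mxE !eqxx => /esym/eqP; rewrite oner_eq0.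
  have := l_pos x x_neq0; rewrite quadratic_form_spectral (bigD1 i) //= QTx.
  rewrite big1 => [|j /negPf j_neq]; last by rewrite mxE j_neq expr0n mulr0.
  by rewrite mxE !eqxx expr1n mulr1 addr0.
split=> [|x x_neq0].
  by apply/symmetricmxP; rewrite !trmx_mul trmxK tr_diag_mx mulmxA.
have term_ge0 i : 0 <= l i * (Q^T *m x) i 0 ^+ 2.
  by rewrite mulr_ge0 ?sqr_ge0 ?ltW.
rewrite quadratic_form_spectral lt_def sumr_ge0 ?andbT //.
apply: contra_neq x_neq0 => /eqP; rewrite psumr_eq0 // => /allP terms0.
have y0 : Q^T *m x = 0.
  apply/colP => i; rewrite [RHS]mxE; apply/eqP.
  by have := terms0 i (mem_index_enum i); rewrite mulf_eq0 gt_eqF //= sqrf_eq0.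
by rewrite -[x]mul1mx -Q_orthogonal -mulmxA y0 mulmx0.
Qed.

(** Antisymmetry makes a greatest eigenvalue unique, which is what removes the
    choice operator from [lambda_max]. *)
Lemma lambda_max_spectral l i0 :
  (forall i, l i <= l i0) -> lambda_max (spectral_mx Q l) = l i0.
Proof.
move=> l_le; apply: xget_unique => [|a [a_eig a_ub]].
  split=> [|a]; first by apply/eigenvalue_spectral; exists i0.
  by move=> /eigenvalue_spectral[i ->].
apply/le_anti/andP; split; last first.
  by apply: a_ub; apply/eigenvalue_spectral; exists i0.
by have /eigenvalue_spectral[i ->] := a_eig.
Qed.

Lemma lambda_min_spectral l i0 :
  (forall i, l i0 <= l i) -> lambda_min (spectral_mx Q l) = l i0.
Proof.
move=> l_ge; apply: xget_unique => [|a [a_eig a_lb]].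
  split=> [|a]; first by apply/eigenvalue_spectral; exists i0.
  by move=> /eigenvalue_spectral[i ->].
apply/le_anti/andP; split.
  by apply: a_lb; apply/eigenvalue_spectral; exists i0.
by have /eigenvalue_spectral[i ->] := a_eig.
Qed.

End SpectralMatrix.

(** * The noise schedule acting on one eigenvalue *)

Lemma beta_sqr (K : realType) (t : K) : 0 <= t -> beta t ^+ 2 = t.
Proof. exact: sqr_sqrtr. Qed.

(** The two weights never vanish together on [[0, 1]]. *)
Lemma shrink_gt0 (K : realType) (t x : K) :
  0 <= t <= 1 -> 0 < x -> 0 < alpha t ^+ 2 + beta t ^+ 2 * x.
Proof.
move=> /andP[t_ge0 t_le1] x_gt0; rewrite beta_sqr // /alpha.
have [-> | t_neq0] := eqVneq t 0; first by rewrite subr0 expr1n mul0r addr0.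
by rewrite ltr_wpDl ?sqr_ge0 // mulr_gt0 // lt_def t_neq0.
Qed.

Lemma shrink_le (K : realType) (t x y : K) :
  0 <= t <= 1 -> 0 < x -> x <= y ->
  x / (alpha t ^+ 2 + beta t ^+ 2 * x) <= y / (alpha t ^+ 2 + beta t ^+ 2 * y).
Proof.
move=> t01 x_gt0 xy; have y_gt0 := lt_le_trans x_gt0 xy.
rewrite ler_pdivrMr ?shrink_gt0 // [_ / _ * _]mulrAC.
rewrite ler_pdivlMr ?shrink_gt0 //.
by rewrite !mulrDr [x * (_ * y)]mulrCA [y * (_ * x)]mulrCA [y * x]mulrC lerD2r
  ler_wpM2r ?sqr_ge0.
Qed.

(** After cross-multiplication the difference of the two sides factors as
    [(y - x) * (t * (1 - s) ^+ 2 - s * (1 - t) ^+ 2)], where both factors are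
    nonnegative because [s <= t] and [1 - t <= 1 - s]. *)
Lemma shrink_ratio_le (K : realType) (s t x y : K) :
  0 <= s -> s <= t -> t <= 1 -> 0 < x -> x <= y ->
  (alpha t ^+ 2 + beta t ^+ 2 * x) / (alpha t ^+ 2 + beta t ^+ 2 * y) <=
  (alpha s ^+ 2 + beta s ^+ 2 * x) / (alpha s ^+ 2 + beta s ^+ 2 * y).
Proof.
move=> s_ge0 st t_le1 x_gt0 xy; have y_gt0 := lt_le_trans x_gt0 xy.
have t_ge0 := le_trans s_ge0 st; have s_le1 := le_trans st t_le1.
rewrite ler_pdivrMr ?shrink_gt0 ?t_ge0 // [_ / _ * _]mulrAC.
rewrite ler_pdivlMr ?shrink_gt0 ?s_ge0 // !beta_sqr // /alpha -subr_ge0.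
have -> : ((1 - s) ^+ 2 + s * x) * ((1 - t) ^+ 2 + t * y) -
    ((1 - t) ^+ 2 + t * x) * ((1 - s) ^+ 2 + s * y) =
    (y - x) * (t * (1 - s) ^+ 2 - s * (1 - t) ^+ 2) by ring.
rewrite mulr_ge0 ?subr_ge0 // ler_pM ?sqr_ge0 //.
by rewrite lerXn2r ?nnegrE ?subr_ge0 // lerD2l lerN2.
Qed.

(** * The diffusion curvature *)

Section DiffusionCurvature.
Variables (K : realType) (n : nat) (Q : 'M[K]_n) (l : 'I_n -> K).
Hypotheses (Q_orthogonal : Q *m Q^T = 1%:M) (l_gt0 : forall i, 0 < l i).
Let A := spectral_mx Q l.

Lemma diffusion_curvature_spectral (t : K) : 0 <= t <= 1 ->
  diffusion_curvature A t =
  spectral_mx Q (fun i => l i / (alpha t ^+ 2 + beta t ^+ 2 * l i)).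
Proof.
move=> t01; have l_neq0 i : l i != 0 by rewrite gt_eqF.
have mix i : alpha t ^+ 2 * (l i)^-1 + beta t ^+ 2 =
    (alpha t ^+ 2 + beta t ^+ 2 * l i) / l i.
  by rewrite mulrDl mulfK.
rewrite /diffusion_curvature spectral_mxV // -spectral_mxZ //.
rewrite -(spectral_mx_const Q_orthogonal) -spectral_mxD (eq_spectral_mx _ mix).
rewrite spectral_mxV // => [|i]; last first.
  by rewrite mulf_neq0 ?invr_eq0 // gt_eqF ?shrink_gt0.
by apply: eq_spectral_mx => i; rewrite invf_div.
Qed.

Variables (imin imax : 'I_n).
Hypotheses (imin_le : forall i, l imin <= l i) (le_imax : forall i, l i <= l imax).

Lemma cond_num_diffusion_curvature (t : K) : 0 <= t <= 1 ->
  cond_num (diffusion_curvature A t) =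
  cond_num A * ((alpha t ^+ 2 + beta t ^+ 2 * lambda_min A) /
                (alpha t ^+ 2 + beta t ^+ 2 * lambda_max A)).
Proof.
move=> t01; rewrite diffusion_curvature_spectral // /cond_num.
rewrite (lambda_max_spectral Q_orthogonal le_imax).
rewrite (lambda_min_spectral Q_orthogonal imin_le).
rewrite (@lambda_max_spectral _ _ _ Q_orthogonal _ imax) => [|i]; last first.
  exact: shrink_le.
rewrite (@lambda_min_spectral _ _ _ Q_orthogonal _ imin) => [|i]; last first.
  exact: shrink_le.
by rewrite invf_div mulrACA [RHS]mulrACA [(l imin)^-1 * _]mulrC.
Qed.

End DiffusionCurvature.

Theorem proposition3p2 (K : realType) (d m : nat) (d_gt0 : (0 < d)%N)
    (B : 'M[K]_d) (R : 'M[K]_m) (H : 'M[K]_(m, d))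
    (B_posdef : posdefmx B) (R_posdef : posdefmx R)
    (A : 'M[K]_d) (A_def : A = posterior_curvature B R H)
    (Q : 'M[K]_d) (lambda : 'rV[K]_d)
    (Q_orthogonal : Q *m Q^T = 1%:M)
    (A_eigendecomposition : A = Q *m diag_mx lambda *m Q^T) :
  let lambda_star (t : K) (i : 'I_d) : K :=
    lambda 0 i / (alpha t ^+ 2 + beta t ^+ 2 * lambda 0 i) in
  let kappa_star (t : K) : K := cond_num (diffusion_curvature A t) in
  (* Well-definedness facts asserted along with the definitions. *)
  [/\ posdefmx A,
      0 < lambda_min A,
      (forall i : 'I_d, lambda_min A <= lambda 0 i <= lambda_max A) &
      forall t : K, 0 <= t <= 1 -> posdefmx (diffusion_curvature A t)] /\
  (* (1), as a set and with multiplicities *)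
  (forall t : K, 0 <= t <= 1 ->
    (forall a : K, eigenvalue (diffusion_curvature A t) a <->
       exists i : 'I_d, a = lambda_star t i) /\
    char_poly (diffusion_curvature A t) =
      \prod_(i < d) ('X - (lambda_star t i)%:P)) /\
  (* (2) *)
  (forall t : K, 0 <= t <= 1 ->
    kappa_star t =
      cond_num A * ((alpha t ^+ 2 + beta t ^+ 2 * lambda_min A) /
                    (alpha t ^+ 2 + beta t ^+ 2 * lambda_max A))) /\
  (* (3) *)
  [/\ forall t : K, 0 <= t <= 1 -> kappa_star t <= cond_num A,
      kappa_star 0 = cond_num A,
      kappa_star 1 = 1 &
      forall s t : K, 0 <= s -> s <= t -> t <= 1 ->
        kappa_star t <= kappa_star s].
Proof.
move=> lambda_star kappa_star.
pose l i := lambda 0 i.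
have AE : A = spectral_mx Q l.
  rewrite A_eigendecomposition /spectral_mx; congr (_ *m diag_mx _ *m _).
  by apply/rowP => i; rewrite mxE.
have A_posdef : posdefmx A.
  by rewrite A_def; apply: posdefmx_posterior_curvature.
have l_gt0 : forall i, 0 < l i.
  by apply/(posdefmx_spectral Q_orthogonal); rewrite -AE.
pose i0 := Ordinal d_gt0.
have [imax _ le_imax] := @arg_maxP _ _ _ i0 xpredT l isT.
have [imin _ imin_le] := @arg_minP _ _ _ i0 xpredT l isT.
have {}le_imax i : l i <= l imax by exact: le_imax.
have {}imin_le i : l imin <= l i by exact: imin_le.
have maxE : lambda_max A = l imax by rewrite AE; exact: lambda_max_spectral.
have minE : lambda_min A = l imin by rewrite AE; exact: lambda_min_spectral.
have diffE t : 0 <= t <= 1 ->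
    diffusion_curvature A t = spectral_mx Q (lambda_star t).
  by move=> t01; rewrite AE diffusion_curvature_spectral.
have kappaE t : 0 <= t <= 1 -> kappa_star t =
    cond_num A * ((alpha t ^+ 2 + beta t ^+ 2 * lambda_min A) /
                  (alpha t ^+ 2 + beta t ^+ 2 * lambda_max A)).
  move=> t01; rewrite /kappa_star AE.
  exact: (cond_num_diffusion_curvature Q_orthogonal l_gt0 imin_le le_imax).
have cond_ge0 : 0 <= cond_num A by rewrite /cond_num maxE minE divr_ge0 ?ltW.
have kappa0 : kappa_star 0 = cond_num A.
  rewrite kappaE ?lexx ?ler01 // beta_sqr // !mul0r !addr0 /alpha subr0.
  by rewrite expr1n divr1 mulr1.
have kappa_le s t : 0 <= s -> s <= t -> t <= 1 -> kappa_star t <= kappa_star s.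
  move=> s_ge0 st t_le1.
  rewrite !kappaE ?s_ge0 ?t_le1 ?(le_trans s_ge0 st) ?(le_trans st t_le1) //.
  by rewrite ler_wpM2l // minE maxE shrink_ratio_le.
split; last split; last split.
- split=> //; first by rewrite minE.
    by move=> i; rewrite minE maxE imin_le le_imax.
  move=> t t01; rewrite diffE //; apply/(posdefmx_spectral Q_orthogonal) => i.
  by rewrite divr_gt0 ?shrink_gt0 // -/(l i).
- move=> t t01; rewrite diffE //; split; last exact: char_poly_spectral.
  by move=> a; apply: eigenvalue_spectral.
- exact: kappaE.
split=> //.
- by move=> t /andP[t_ge0 t_le1]; rewrite -kappa0 kappa_le.
rewrite kappaE ?ler01 ?lexx // beta_sqr // /alpha subrr expr0n !add0r !mul1r.
by rewrite /cond_num -invf_div mulVf // mulf_neq0 ?invr_eq0 // ?minE ?maxE gt_eqF.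
Qed.
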